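(* Let $(F_n)_{n\ge 0}$ be the Fibonacci sequence, defined by $F_0=0$, $F_1=1$ and $F_n=F_{n-1}+F_{n-2}$ for all $n\ge 2$. Then for all integers $a,b$ with $a>b>1$, \[ \sum_{n=1}^{b}\frac{(-1)^n F_a}{F_n F_{n+a}}=\sum_{n=1}^{a}\frac{(-1)^n F_b}{F_n F_{n+b}}. \]
   Context: The sums are sums of rational (or real) numbers. The Fibonacci numbers are indexed by $F_0=0$, $F_1=1$, $F_n=F_{n-1}+F_{n-2}$ for $n\ge 2$, so $F_n>0$ for all $n\ge 1$. *)

(* Defs.v *)
From mathcomp Require Import all_boot all_order all_algebra.

Set Implicit Arguments.
Unset Strict Implicit.
Unset Printing Implicit Defensive.

Fixpoint fib (n : nat) : nat :=
  match n with
  | 0 => 0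
  | 1 => 1
  | (m.+1 as p).+1 => fib p + fib m
  end.

Lemma fib0 : fib 0 = 0. Proof. by []. Qed.

Lemma fib1 : fib 1 = 1. Proof. by []. Qed.

Lemma fibSS n : fib n.+2 = fib n.+1 + fib n. Proof. by []. Qed.

Lemma fib_gt0 n : 0 < n -> 0 < fib n.
Proof.
case: n => // n _; elim: n => // n IHn.
by rewrite fibSS addn_gt0 IHn.
Qed.

(* Main.v *)
Require Import Defs.
From mathcomp Require Import all_boot all_order all_algebra.
From mathcomp Require Import ring.
Import Order.TTheory GRing.Theory Num.Theory.
Local Open Scope ring_scope.

(** By d'Ocagne's identity the [n]-th summand is [r n - r (n + a)], where
    [r n = F_(n+1) / F_n]. Hence the left-hand side is
    [(r 1 + ... + r b) + (r 1 + ... + r a) - (r 1 + ... + r (a + b))],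
    which is symmetric in [a] and [b]. *)

Lemma fib_dOcagne (R : comNzRingType) (a n : nat) :
  (fib n.+1)%:R * (fib (n + a))%:R - (fib (n + a).+1)%:R * (fib n)%:R
    = (-1) ^+ n * (fib a)%:R :> R.
Proof.
elim: n => [|n IHn]; first by rewrite fib0 fib1 add0n; ring.
by rewrite exprS -mulrA -IHn addSn !fibSS !natrD; ring.
Qed.

Definition fib_ratio (n : nat) : rat := (fib n.+1)%:R / (fib n)%:R.

Lemma fib_ratio_sub (a n : nat) : (0 < n)%N ->
  ((-1) ^+ n * (fib a)%:R) / ((fib n)%:R * (fib (n + a))%:R)
    = fib_ratio n - fib_ratio (n + a).
Proof.
move=> n_gt0; rewrite -fib_dOcagne /fib_ratio.
have fib_neq0 m : (0 < m)%N -> (fib m)%:R != 0 :> rat.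
  by move=> m_gt0; rewrite pnatr_eq0 -lt0n fib_gt0.
by field; rewrite !fib_neq0 // addn_gt0 n_gt0.
Qed.

Lemma sum_fib_ratio_sub (a b : nat) :
  \sum_(1 <= n < b.+1)
     ((-1) ^+ n * (fib a)%:R) / ((fib n)%:R * (fib (n + a))%:R) =
  \sum_(1 <= n < b.+1) fib_ratio n + \sum_(1 <= n < a.+1) fib_ratio n
    - \sum_(1 <= n < (a + b).+1) fib_ratio n.
Proof.
under eq_big_nat => n /andP[n_gt0 _] do rewrite fib_ratio_sub //.
rewrite sumrB (@big_cat_nat _ _ _ a.+1 1 (a + b).+1) ?ltnS ?leq_addr //=.
rewrite -[in X in _ = _ - (_ + X)]add1n big_addn subSn ?leq_addr // addKn.
by ring.
Qed.

Theorem proposition3p4 (a b : nat) (hba : (b < a)%N) (hb : (1 < b)%N) :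
  \sum_(1 <= n < b.+1)
     ((-1) ^+ n * (fib a)%:R) / ((fib n)%:R * (fib (n + a))%:R) =
  \sum_(1 <= n < a.+1)
     ((-1) ^+ n * (fib b)%:R) / ((fib n)%:R * (fib (n + b))%:R) :> rat.
Proof.
by rewrite !sum_fib_ratio_sub [(b + a)%N]addnC [X in X - _]addrC.
Qed.
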